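(* Let $(G_n)_n$ be a sequence of finite non-Abelian groups. Then $c(G_n)\to 0$ as $n\to\infty$ if and only if $k(G_n)\to\infty$ as $n\to\infty$.
   Context: For a finite group $G$, the commuting probability is $c(G):=\frac{1}{|G|^2}\#\{(x,y)\in G^2: xy=yx\}$. A cover of $G$ of size $k$ is a collection of $k$ subsets of $G$ whose union is $G$. For $G$ finite and non-Abelian, the non-commuting Schur number $k(G)$ is the largest natural number such that for every cover $\mathcal{C}$ of $G$ of size $k(G)$ there exist $A\in\mathcal{C}$ and $x,y\in G$ with $x,y,xy,yx\in A$ and $xy\neq yx$. *)

(* Defs.v *)
From mathcomp Require Import all_boot all_order all_algebra all_fingroup.

Set Implicit Arguments.
Unset Strict Implicit.
Unset Printing Implicit Defensive.

Definition commuting_prob (R : fieldType) (gT : finGroupType)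
    (G : {group gT}) : R :=
  (#|[set p : gT * gT | [&& p.1 \in G, p.2 \in G &
                           (p.1 * p.2 == p.2 * p.1)%g]]|%:R
     / #|G|%:R ^+ 2)%R.

(* A cover of size k is a family of k sets, possibly with repetitions: if the
   k sets had to be distinct there would be no cover of size k > 2 ^ #|G|, and
   every such k would satisfy [schur_property].  As the union is exactly G,
   each C i is a subset of G. *)
Definition is_cover (gT : finGroupType) (G : {set gT}) (k : nat)
    (C : {ffun 'I_k -> {set gT}}) : bool :=
  \bigcup_(i < k) C i == G.

Definition has_noncommuting_schur_pair (gT : finGroupType) (A : {set gT}) :
    bool :=
  [exists x, exists y,
    [&& x \in A, y \in A, (x * y)%g \in A, (y * x)%g \in A
      & (x * y != y * x)%g]].

Definition schur_property (gT : finGroupType) (G : {group gT}) (k : nat) :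
    bool :=
  [forall C : {ffun 'I_k -> {set gT}},
    is_cover G C ==> [exists i, has_noncommuting_schur_pair (C i)]].

Lemma schur_property_ex (gT : finGroupType) (G : {group gT}) :
  exists k, schur_property G k.
Proof.
exists 0; apply/forallP => C; apply/implyP; rewrite /is_cover big_ord0 => /eqP G0.
by have := group1 G; rewrite -G0 inE.
Qed.

Lemma schur_property_bound (gT : finGroupType) (G : {group gT}) (k : nat) :
  schur_property G k -> k <= #|G|.
Proof.
move=> /forallP schurk; case: leqP => // /ltnW leGk.
pose C := [ffun i : 'I_k => [set nth 1%g (enum G) i]].
have covC : is_cover G C.
  apply/eqP/setP => x; apply/bigcupP/idP => [[i _]|xG].
    rewrite ffunE => /set1P ->; have [lti|lei] := ltnP i (size (enum G)).
      by rewrite -mem_enum mem_nth.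
    by rewrite nth_default.
  have ltx : index x (enum G) < k.
    by apply: leq_trans leGk; rewrite cardE index_mem mem_enum.
  exists (Ordinal ltx) => //; rewrite ffunE inE /= nth_index ?mem_enum //.
have /implyP/(_ covC)/existsP[i /existsP[x /existsP[y]]] := schurk C.
rewrite ffunE.
by case/and5P=> /set1P-> /set1P-> _ _; rewrite eqxx.
Qed.

Definition schur_number (gT : finGroupType) (G : {group gT}) : nat :=
  ex_maxn (schur_property_ex G) (@schur_property_bound gT G).

Lemma schur_numberP (gT : finGroupType) (G : {group gT}) :
  schur_property G (schur_number G) /\
  (forall k, schur_property G k -> k <= schur_number G).
Proof. by rewrite /schur_number; case: ex_maxnP. Qed.

(* Main.v *)
Require Import Defs.
From mathcomp Require Import all_boot all_order all_algebra all_fingroup.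
From mathcomp Require Import all_classical all_reals all_analysis.
From mathcomp Require Import ring lra zify.
Import numFieldNormedType.Exports.

(* If c(G) >= 1/b, then with B = 2b the set X of elements with at most B
   conjugates has density at least 1/B, so at most B pairwise disjoint
   translates t X fit in G and, taking a maximal family, the sets t X X^-1
   cover G.  Elements with at most B^4 conjugates are coloured injectively on
   each conjugacy class, which separates x y from its conjugate y x; any other
   x is coloured by a t such that x is in t X X^-1, and if x and x y get the
   same t, then y is in (X X^-1)^-1 (X X^-1) and has at most B^4 conjugates.

   Conversely, every colouring of G with k colours has at least delta(k) |G|^2
   pairs (x, g) with x, g, x g, g x of one colour, which cannot all commute if
   c(G) < delta(k).  For a, b, c in G put g = a^-1 c b^-1 and x_i = b t_i a, so
   that x_i g = b t_i c b^-1 and g x_i = a^-1 c t_i a: the condition that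
   x_i, x_i g and g x_i have colour i for every dense colour i defines a
   tripartite graph on (a, b, c).  Its triangles with c = a b (that is, g = 1)
   are edge-disjoint, and there are many of them for a suitable t, so triangle
   removal gives many triangles.  If the densities of the colours leave a large
   enough gap, then g has a dense colour i for most of these triangles, and
   x_i, g, x_i g, g x_i all have colour i. *)

Set Implicit Arguments.
Unset Strict Implicit.
Unset Printing Implicit Defensive.

Import Order.TTheory GRing.Theory Num.Theory.

(** * Groups with many commuting pairs *)

Definition small_classes (gT : finGroupType) (G : {group gT}) (B : nat) :
    {set gT} :=
  [set x in G | #|x ^: G|%g <= B].

(** Conjugation is multiplicative, so the class of [x * y] lies in the product set of the two
    classes. *)
Lemma small_classesM (gT : finGroupType) (G : {group gT}) B1 B2 x y :
  x \in small_classes G B1 -> y \in small_classes G B2 ->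
  (x * y)%g \in small_classes G (B1 * B2).
Proof.
rewrite !inE => /andP[xG xB] /andP[yG yB]; rewrite groupM //=.
apply: leq_trans (leq_mul xB yB); rewrite -cardsX.
apply: leq_trans (leq_imset_card (fun p => (p.1 * p.2)%g) _).
apply/subset_leq_card/fintype.subsetP => _ /imsetP[z zG ->]; rewrite conjMg.
by apply/imsetP; exists (x ^ z, y ^ z)%g; rewrite // inE !memJ_class.
Qed.

Lemma small_classesV (gT : finGroupType) (G : {group gT}) B x :
  x \in small_classes G B -> (x^-1)%g \in small_classes G B.
Proof. by rewrite !inE groupV classVg card_invg. Qed.

Lemma schur_property_colouring (gT : finGroupType) (G : {group gT}) n
    (c : gT -> nat) :
  schur_property G n -> (forall x, x \in G -> c x < n) ->
  exists x y, [/\ x \in G, y \in G, (x * y != y * x)%g &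
    [/\ c y = c x, c (x * y)%g = c x & c (y * x)%g = c x]].
Proof.
move=> /forallP/(_ [ffun i : 'I_n => [set x in G | c x == i]]) /implyP H cn.
have /H/existsP[i /existsP[x /existsP[y]]] :
    is_cover G [ffun i : 'I_n => [set x in G | c x == i]].
  apply/eqP/setP => x; apply/bigcupP/idP => [[i _]|xG].
    by rewrite ffunE inE => /andP[].
  by exists (Ordinal (cn _ xG)); rewrite ?ffunE ?inE ?xG /=.
rewrite ffunE !inE => /and5P[/andP[xG /eqP cx] /andP[yG /eqP cy]].
move=> /andP[_ /eqP cxy] /andP[_ /eqP cyx] xy.
by exists x, y; rewrite cx cy cxy cyx.
Qed.

Definition commuting_pairs (gT : finGroupType) (G : {group gT}) :
    {set gT * gT} :=
  [set p : gT * gT | [&& p.1 \in G, p.2 \in G & (p.1 * p.2 == p.2 * p.1)%g]].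

Lemma card_commuting_pairs (gT : finGroupType) (G : {group gT}) :
  #|commuting_pairs G| = \sum_(x in G) #|('C_G[x])%g|.
Proof.
rewrite -sum1_card (partition_big fst (mem G)) /=; last first.
  by move=> p; rewrite inE => /and3P[].
apply: eq_bigr => x xG; rewrite -sum1_card.
rewrite (reindex_onto (fun y => (x, y)) snd) /=; last first.
  by move=> [a b] /andP[_ /eqP] /= ->.
apply: eq_bigl => y; rewrite finset.in_set finset.in_setI /= !eqxx !andbT xG /=.
by congr (_ && _); apply/eqP/cent1P => [|] /esym.
Qed.

(** An element outside X has a centraliser of order below |G|/(2b), so such elements account for at
    most half of the assumed |G|^2/b commuting pairs. The other half must come from X, each of whose
    elements commutes with at most |G| others. *)
Lemma many_small_classes (gT : finGroupType) (G : {group gT}) b :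
  #|G| ^ 2 <= b * #|commuting_pairs G| ->
  #|G| <= 2 * b * #|small_classes G (2 * b)|.
Proof.
rewrite card_commuting_pairs => comm; set X := small_classes G _.
suff : 2 * b * \sum_(x in G) #|('C_G[x])%g| <= 2 * b * #|X| * #|G| + #|G| ^ 2.
  have := cardG_gt0 G; nia.
apply: (@leq_trans (\sum_(x in G) (2 * b * #|G| * (x \in X) + #|G|))).
  rewrite big_distrr; apply: leq_sum => x xG /=.
  case: (boolP (x \in X)) => [_|].
    rewrite muln1 (leq_trans _ (leq_addr _ _)) // leq_mul2l.
    by rewrite subset_leq_card ?orbT // finset.subsetIl.
  rewrite muln0 add0n inE xG /= -ltnNge => xX.
  by rewrite -[leqRHS](Lagrange (finset.subsetIl G 'C[x]%g)) index_cent1 mulnC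
    leq_mul2l ltnW ?orbT.
rewrite big_split sum_nat_const mulnn leq_add2r -big_distrr /= mulnAC leq_mul2r.
apply/orP; right; rewrite leq_mul2l; apply/orP; right.
rewrite -sum1_card [leqRHS]big_mkcond [leqLHS]big_mkcond.
by apply: leq_sum => x _; case: ifP; case: (x \in X).
Qed.

Lemma small_schur_number (gT : finGroupType) (G : {group gT}) b n :
  #|G| ^ 2 <= b * #|commuting_pairs G| ->
  (2 * b) ^ 4 + 2 * b <= n -> ~~ schur_property G n.
Proof.
move=> comm nb; apply/negP => Gn.
pose B := 2 * b; pose X := small_classes G B.
pose Y := small_classes G (B * B); pose Z := small_classes G (B * B * (B * B)).
have XG x : x \in X -> x \in G by rewrite inE => /andP[].
have GX : #|G| <= B * #|X| by exact: many_small_classes.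
have X1 : 1%g \in X.
  rewrite inE group1 class1G cards1 lt0n; apply: contraTneq GX => ->.
  by rewrite mul0n -ltnNge cardG_gt0.
(* The translates s X, for s in T, are pairwise disjoint. *)
pose packed (T : {set gT}) := (T \subset G) &&
  [forall s in T, forall t in T, forall u in X, forall v in X,
     (s * u == t * v)%g ==> (s == t)].
have packedP (T : {set gT}) s t u v : packed T -> s \in T -> t \in T ->
    u \in X -> v \in X -> (s * u = t * v)%g -> s = t.
  case/andP=> _ /forall_inP H sT tT uX vX /eqP E.
  have /forall_inP/(_ t tT)/forall_inP/(_ u uX)/forall_inP/(_ v vX) := H s sT.
  by rewrite E => /eqP.
have [T /maxsetP[pT Tmax]] : {T | maxset packed T}.
  apply: ex_maxset; exists finset.set0; rewrite /packed finset.sub0set.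
  by apply/forall_inP => s; rewrite inE.
have TG t : t \in T -> t \in G.
  by case/andP: pT => /fintype.subsetP TG _; exact: TG.
have TB : #|T| <= B.
  rewrite -(leq_pmul2r (_ : 0 < #|X|)); last by apply/card_gt0P; exists 1%g.
  apply: leq_trans GX; rewrite -cardsX.
  rewrite -(card_in_imset (f := fun p => (p.1 * p.2)%g)).
    apply/subset_leq_card/fintype.subsetP => _ /imsetP[[t u] + ->].
    rewrite finset.in_setX /= => /andP[tT uX].
    by apply: groupM; [exact: TG | exact: XG].
  move=> [s u] [t v]; rewrite !finset.in_setX /= => /andP[sT uX] /andP[tT vX] E.
  have st := packedP _ _ _ _ _ pT sT tT uX vX E.
  by move: E; rewrite st => /mulgI ->.
have cover g : g \in G -> exists2 t, t \in T & (t^-1 * g)%g \in Y.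
  move=> gG.
  have [/exists_inP[t tT tg]|/exists_inPn far] :=
    boolP [exists t in T, (t^-1 * g)%g \in Y]; first by exists t.
  have YV u v : u \in X -> v \in X -> (u * v^-1)%g \in Y.
    by move=> uX vX; rewrite small_classesM // small_classesV.
  (* If g were far from T, its translate would be disjoint from all others; maximality then puts g
     itself in T. *)
  have : packed (g |: T).
    rewrite /packed finset.subUset finset.sub1set gG.
    case/andP: (pT) => -> _ /=.
    apply/forall_inP => s sT; apply/forall_inP => t tT.
    apply/forall_inP => u uX; apply/forall_inP => v vX; apply/implyP => /eqP E.
    move: sT tT; rewrite !inE => /orP[/eqP sg|sT] /orP[/eqP tg|tT].
    - by rewrite sg tg.
    - have := far t tT; suff -> : (t^-1 * g = v * u^-1)%g by rewrite YV.
      by apply: (mulgI t); apply: (mulIg u); rewrite mulKVg -sg E mulgA mulgKV.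
    - have := far s sT; suff -> : (s^-1 * g = u * v^-1)%g by rewrite YV.
      by apply: (mulgI s); apply: (mulIg v); rewrite mulKVg -tg -E mulgA mulgKV.
    - by apply/eqP; exact: (packedP _ _ _ _ _ pT sT tT uX vX E).
  move=> /Tmax /(_ (finset.subsetUr _ _)) TE.
  exists g; first by rewrite -TE finset.setU11.
  by rewrite mulVg -(mulgV 1%g); exact: YV.
pose rep g := odflt 1%g [pick t in T | (t^-1 * g)%g \in Y].
have repP g : g \in G -> rep g \in T /\ ((rep g)^-1 * g)%g \in Y.
  move=> /cover[t tT tg]; rewrite /rep; case: pickP => [s /andP[] //|/(_ t)].
  by rewrite tT tg.
(* The first B^4 colours number the elements of each class inside Z; at most B further colours name
   the translate that covers an element outside Z. *)
pose c g := if g \in Z then index g (enum (g ^: G)%g)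
            else B * B * (B * B) + index (rep g) (enum T).
have cZ g : g \in G -> (c g < B * B * (B * B)) = (g \in Z).
  move=> gG; rewrite /c; case: ifP => [|_]; last by rewrite ltnNge leq_addr.
  rewrite inE => /andP[_]; apply: leq_trans.
  by rewrite cardE index_mem mem_enum class_refl.
have B4 : B ^ 4 = B * B * (B * B) by rewrite (expnD B 2 2) !mulnn.
have cn g : g \in G -> c g < n.
  move=> gG; apply: leq_trans nb; rewrite -/B B4.
  case: (boolP (g \in Z)) => [|gZ].
    by rewrite -cZ // => /leq_trans; apply; exact: leq_addr.
  rewrite /c (negbTE gZ) ltn_add2l (leq_trans _ TB) // cardE index_mem mem_enum.
  by case: (repP g gG).
have [x [y [xG yG xy [cy cxy cyx]]]] := schur_property_colouring Gn cn.
have repE g : g \in G -> x \notin Z -> c g = c x -> rep g = rep x.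
  move=> gG xZ gx; have gZ : g \notin Z by rewrite -cZ // gx cZ.
  have [gT' _] := repP g gG; have [xT' _] := repP x xG.
  move: gx; rewrite /c (negbTE gZ) (negbTE xZ) => /addnI.
  by apply: (index_inj x); rewrite mem_enum.
case: (boolP (x \in Z)) => xZ.
  have xyZ : (x * y)%g \in Z by rewrite -cZ ?groupM // cxy cZ.
  have yxZ : (y * x)%g \in Z by rewrite -cZ ?groupM // cyx cZ.
  (* [x * y] and [y * x] are conjugate, and [c] is injective on each class. *)
  have classE : ((y * x) ^: G = (x * y) ^: G)%g.
    by rewrite -(classGidl (x * y)%g xG) /conjg !mulgA mulVg mul1g.
  case/eqP: xy; move: (etrans cxy (esym cyx)); rewrite /c xyZ yxZ classE.
  apply: (index_inj x); rewrite mem_enum ?class_refl //.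
  by rewrite -classE class_refl.
(* Outside Z the colour determines [rep], so x and x y share it. Then y is a quotient of two
   elements of Y, hence lies in Z, although it has the colour of x. *)
have [tT xY] := repP x xG.
have [_] := repP (x * y)%g (groupM xG yG).
rewrite (repE _ (groupM xG yG) xZ cxy) => xyY.
have : y \in Z.
  have -> : (y = ((rep x)^-1 * x)^-1 * ((rep x)^-1 * (x * y)))%g.
    by rewrite invMg invgK !mulgA mulgK mulVg mul1g.
  by rewrite small_classesM // small_classesV.
by rewrite -cZ // cy cZ // (negbTE xZ).
Qed.

Local Open Scope ring_scope.

(** * Conditional expectations *)

Section ConditionalExpectation.
Context {R : realFieldType} {T : finType} {L : eqType}.
Implicit Types (lab : T -> L) (f h : T -> R).

(** The average of f over the cell of x, that is, the conditional expectation of f given [lab]. *)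
Definition cexp lab f (x : T) : R :=
  (\sum_(y | lab y == lab x) f y) / (\sum_(y | lab y == lab x) 1).

Lemma cexp_lab lab f x y : lab x = lab y -> cexp lab f x = cexp lab f y.
Proof. by rewrite /cexp => ->. Qed.

Lemma cell_gt0 lab (x : T) : 0 < \sum_(y | lab y == lab x) 1 :> R.
Proof. by rewrite (bigD1 x) //= ltr_wpDr // sumr_ge0. Qed.

Lemma cexp_mul_cell lab f x :
  cexp lab f x * (\sum_(y | lab y == lab x) 1) = \sum_(y | lab y == lab x) f y.
Proof. by rewrite /cexp divfK // gt_eqF // cell_gt0. Qed.

Lemma sum_cexpM lab f h : (forall x y, lab x = lab y -> h x = h y) ->
  \sum_x cexp lab f x * h x = \sum_x f x * h x.
Proof.
move=> hE.
transitivity (\sum_x \sum_(y | lab y == lab x)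
    f y * h y / (\sum_(z | lab z == lab y) 1)).
  apply: eq_bigr => x _; rewrite /cexp mulrAC mulr_suml mulr_suml.
  by apply: eq_bigr => y /eqP xy; rewrite xy (hE _ _ xy).
rewrite (exchange_big_dep xpredT) //=; apply: eq_bigr => y _.
under eq_bigl do rewrite eq_sym.
have c0 := cell_gt0 lab y.
rewrite -[RHS](divfK (lt0r_neq0 c0)) mulr_sumr.
by apply: eq_bigr => x _; rewrite mulr1.
Qed.

(** The indicator is constant on cells, so f may be replaced by its average, which is below e
    wherever the indicator is 1. Applied to edges, this bounds those lying in sparse cells. *)
Lemma sum_cexp_low lab f (e : R) : 0 <= e ->
  \sum_x f x * (cexp lab f x < e)%R%:R <= e * #|T|%:R.
Proof.
move=> e0; rewrite -(sum_cexpM (lab := lab)); last first.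
  by move=> x y /(cexp_lab f) ->.
rewrite -sumr_const mulr_sumr; apply: ler_sum => x _; rewrite mulr1.
by case: ltP => [/ltW|_]; rewrite ?mulr1 ?mulr0.
Qed.

Lemma energy_le lab f : \sum_x cexp lab f x ^+ 2 <= \sum_x f x ^+ 2.
Proof.
have : 0 <= \sum_x (f x - cexp lab f x) ^+ 2.
  by apply: sumr_ge0 => x _; exact: sqr_ge0.
under eq_bigr do rewrite sqrrB.
rewrite big_split sumrB /= sumrMnl.
rewrite -(sum_cexpM f (@cexp_lab lab f)).
under [X in _ - X *+ _]eq_bigr do rewrite -expr2.
lra.
Qed.

End ConditionalExpectation.

(** Pythagoras: the coarse average is the orthogonal projection of the fine one. *)
Lemma energy_refine {R : realFieldType} {T : finType} {L L' : eqType}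
    (lab : T -> L) (lab' : T -> L') (f : T -> R) :
  (forall x y, lab' x = lab' y -> lab x = lab y) ->
  \sum_x (cexp lab' f x - cexp lab f x) ^+ 2 =
  \sum_x cexp lab' f x ^+ 2 - \sum_x cexp lab f x ^+ 2.
Proof.
move=> refl.
under eq_bigr do rewrite sqrrB.
rewrite big_split sumrB /= sumrMnl
  (sum_cexpM (lab := lab') f (h := cexp lab f)); last first.
  by move=> x y /refl; exact: cexp_lab.
rewrite -(sum_cexpM f (@cexp_lab _ _ _ lab f)).
under [X in _ - X *+ _]eq_bigr do rewrite -expr2.
ring.
Qed.

(** * Triangle removal *)

Lemma sum_cells {R : nmodType} {T U I J : finType} (phi : T -> I) (psi : U -> J)
    (F : T -> U -> R) :
  \sum_b \sum_c F b c =
  \sum_i \sum_j \sum_(b | phi b == i) \sum_(c | psi c == j) F b c.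
Proof.
rewrite (partition_big phi xpredT) //=; apply: eq_bigr => i _.
rewrite [RHS]exchange_big /=; apply: eq_bigr => b _.
by rewrite (partition_big psi xpredT).
Qed.

(* Only [E3] is regularised, and only against pairs of neighbourhoods of a
   single vertex [a], which is all that counting triangles requires. *)
Section Regularity.
Context {R : realFieldType} {T I J : finType}.
Variables (E1 E2 E3 : rel T) (phi : T -> I) (psi : T -> J) (e : R).
Hypothesis e0 : 0 < e.

Definition density (p : T * T) : R :=
  cexp (fun p => (phi p.1, psi p.2)) (fun p => (E3 p.1 p.2)%:R) p.

(* The neighbourhoods of [a] in the cells [i] and [j] are large but span fewer
   edges of [E3] than the density of the pair of cells predicts. *)
Definition irregular_at (i : I) (j : J) (a : T) : bool :=
  [&& e * (\sum_(b | phi b == i) 1) <= \sum_(b | phi b == i) (E1 a b)%:R,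
      e * (\sum_(c | psi c == j) 1) <= \sum_(c | psi c == j) (E2 a c)%:R
    & 0 < \sum_(b | phi b == i) \sum_(c | psi c == j)
            (E1 a b)%:R * (E2 a c)%:R *
            (density (b, c) - e / 2 - (E3 b c)%:R)].

Definition irregular (i : I) (j : J) : bool := [exists a, irregular_at i j a].

(** The neighbourhoods of [a] in the two cells have at least e s points each, and regularity gives
    them edge density at least e - e/2. *)
Lemma regular_triangles (s : R) (a b0 c0 : T) :
    0 <= s ->
    s <= \sum_(b | phi b == phi b0) 1 -> s <= \sum_(c | psi c == psi c0) 1 ->
    e <= cexp phi (fun b => (E1 a b)%:R) b0 ->
    e <= cexp psi (fun c => (E2 a c)%:R) c0 ->
    e <= density (b0, c0) -> ~~ irregular (phi b0) (psi c0) ->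
  e ^+ 3 / 2 * s ^+ 2 <= \sum_b \sum_c ([&& E1 a b, E2 a c & E3 b c])%:R.
Proof.
move=> s0 sP sQ eP eQ ed /existsPn/(_ a); rewrite /irregular_at.
set P := (X in e * X <= _); set n1 := (X in _ <= X).
set Q := (X in [&& _, e * X <= _ & _]); set n2 := (X in [&& _, _ <= X & _]).
have n1E : e * P <= n1.
  by rewrite /n1 -cexp_mul_cell ler_wpM2r // (le_trans s0).
have n2E : e * Q <= n2.
  by rewrite /n2 -cexp_mul_cell ler_wpM2r // (le_trans s0).
rewrite n1E n2E /= -leNgt => reg.
have n12 : n1 * n2 = \sum_(b | phi b == phi b0) \sum_(c | psi c == psi c0)
    (E1 a b)%:R * (E2 a c)%:R by rewrite big_distrlr.
have cells : e / 2 * (n1 * n2) <= \sum_(b | phi b == phi b0)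
    \sum_(c | psi c == psi c0) ([&& E1 a b, E2 a c & E3 b c])%:R.
  rewrite -subr_le0 n12 mulr_sumr -sumrB; apply: le_trans reg.
  apply: ler_sum => b /eqP bP; rewrite mulr_sumr -sumrB.
  apply: ler_sum => c /eqP cQ.
  have -> : density (b, c) = density (b0, c0).
    by apply: cexp_lab; rewrite /= bP cQ.
  case: (E1 a b); case: (E2 a c); case: (E3 b c);
    by rewrite /= ?mulr0n ?mulr1n; lra.
have /le_trans : e ^+ 3 / 2 * s ^+ 2 <= e / 2 * (n1 * n2).
  have -> : e ^+ 3 / 2 * s ^+ 2 = e / 2 * ((e * s) * (e * s)) by ring.
  have es : 0 <= e * s by rewrite mulr_ge0 // ltW.
  apply: ler_wpM2l; first by rewrite divr_ge0 ?ltW.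
  apply: ler_pM => //.
    by apply: le_trans n1E; rewrite ler_pM2l.
  by apply: le_trans n2E; rewrite ler_pM2l.
apply; apply: le_trans cells _; rewrite big_mkcond.
apply: ler_sum => b _; case: ifP => _; last by rewrite sumr_ge0.
by rewrite big_mkcond; apply: ler_sum => c _; case: ifP.
Qed.

Definition witness (i : I) (j : J) : option T := [pick a | irregular_at i j a].

(** Each cell is cut by the neighbourhoods of one witness for every cell of the other partition, so
    M cells become at most M 2^M. *)
Definition refine1 (b : T) : I * {ffun J -> bool} :=
  (phi b, [ffun j => oapp (E1^~ b) false (witness (phi b) j)]).

Definition refine2 (c : T) : J * {ffun I -> bool} :=
  (psi c, [ffun i => oapp (E2^~ c) false (witness i (psi c))]).

Lemma energy_increment :
  e ^+ 4 / 4 * \sum_b \sum_c (irregular (phi b) (psi c))%:R <=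
  \sum_p cexp (fun p => (refine1 p.1, refine2 p.2))
            (fun p => (E3 p.1 p.2)%:R) p ^+ 2 - \sum_p density p ^+ 2.
Proof.
pose lab' (p : T * T) := (refine1 p.1, refine2 p.2).
pose f (p : T * T) : R := (E3 p.1 p.2)%:R.
rewrite -/lab' -/f.
rewrite -energy_refine; last first.
  by move=> [b c] [b' c'] [] /= -> _ -> _.
(* The indicator of the witnesses' neighbourhood rectangles is constant on refined cells, so against
   it f and its refined average have the same sum. *)
pose h (p : T * T) : R :=
  oapp (fun a => (E1 a p.1)%:R * (E2 a p.2)%:R) 0 (witness (phi p.1) (psi p.2)).
have hE p q : lab' p = lab' q -> h p = h q.
  case: p q => [b c] [b' c'] [] /= bP /ffunP b1 cQ /ffunP c1.
  have := b1 (psi c); have := c1 (phi b); rewrite !ffunE /h /= bP cQ.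
  by case: witness => //= a -> ->.
have h01 p : h p = 0 \/ h p = 1.
  rewrite /h; case: witness => [a|] /=; last by left.
  by case: E1; case: E2; rewrite ?mulr0 ?mul0r ?mulr1; auto.
(* The bound x^2 >= e x - e^2/4 makes the gain linear in the refined average, which can then be
   exchanged for f. *)
apply: (@le_trans _ _
    (\sum_p h p * (e * (density p - cexp lab' f p) - e ^+ 2 / 4))); last first.
  apply: ler_sum => p _; rewrite -/(density p).
  have := sqr_ge0 (density p - cexp lab' f p - e / 2).
  have := sqr_ge0 (density p - cexp lab' f p).
  by case: (h01 p) => ->; lra.
have -> : \sum_p h p * (e * (density p - cexp lab' f p) - e ^+ 2 / 4) =
    \sum_p h p * (e * (density p - f p) - e ^+ 2 / 4).
  apply/eqP; rewrite -subr_eq0 -sumrB; apply/eqP.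
  transitivity (\sum_p e * (f p * h p - cexp lab' f p * h p)).
    by apply: eq_bigr => p _; ring.
  by rewrite -mulr_sumr sumrB (sum_cexpM f hE) subrr mulr0.
rewrite -(pair_bigA _ (fun b c => h (b, c) *
    (e * (density (b, c) - f (b, c)) - e ^+ 2 / 4))) /=.
rewrite (sum_cells phi psi) [X in _ <= X](sum_cells phi psi) mulr_sumr.
apply: ler_sum => i _; rewrite mulr_sumr; apply: ler_sum => j _.
set P : R := \sum_(b | phi b == i) 1; set Q : R := \sum_(c | psi c == j) 1.
have -> : \sum_(b | phi b == i) \sum_(c | psi c == j)
    (irregular (phi b) (psi c))%:R = (irregular i j)%:R * (P * Q).
  rewrite big_distrlr /= mulr_sumr; apply: eq_bigr => b /eqP ->.
  by rewrite mulr_sumr; apply: eq_bigr => c /eqP ->; rewrite !mulr1.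
have -> : \sum_(b | phi b == i) \sum_(c | psi c == j)
    h (b, c) * (e * (density (b, c) - f (b, c)) - e ^+ 2 / 4) =
  \sum_(b | phi b == i) \sum_(c | psi c == j)
    oapp (fun a => (E1 a b)%:R * (E2 a c)%:R) 0 (witness i j) *
    (e * (density (b, c) - (E3 b c)%:R) - e ^+ 2 / 4).
  apply: eq_bigr => b /eqP bi; apply: eq_bigr => c /eqP cj.
  by rewrite /h /= bi cj.
rewrite /witness; case: pickP => [a wa|nw] /=; last first.
  have /negbTE -> : ~~ irregular i j by apply/existsPn => a; rewrite nw.
  rewrite mul0r mulr0 big1 // => b _; rewrite big1 // => c _.
  by rewrite mul0r.
have -> : irregular i j by apply/existsP; exists a.
case/and3P: wa; rewrite -/P -/Q mul1r.
set n1 := (X in _ <= X) => n1P; set n2 := (X in _ <= X) => n2Q.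
set D := (X in 0 < X) => D0.
(* The deficit D already includes a margin e/2 per pair, which leaves e^2/2 - e^2/4 for each point
   of the rectangle. *)
have -> : \sum_(b | phi b == i) \sum_(c | psi c == j)
    (E1 a b)%:R * (E2 a c)%:R *
    (e * (density (b, c) - (E3 b c)%:R) - e ^+ 2 / 4) =
  e * D + e ^+ 2 / 4 * (n1 * n2).
  rewrite big_distrlr /= !mulr_sumr -big_split /=; apply: eq_bigr => b _.
  rewrite !mulr_sumr -big_split /=; apply: eq_bigr => c _.
  by field.
apply: (@le_trans _ _ (e ^+ 2 / 4 * (n1 * n2))); last first.
  by rewrite lerDr mulr_ge0 // ltW.
have -> : e ^+ 4 / 4 * (P * Q) = e ^+ 2 / 4 * ((e * P) * (e * Q)) by ring.
apply: ler_wpM2l; first by rewrite divr_ge0 // exprn_ge0 // ltW.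
by apply: ler_pM => //; rewrite mulr_ge0 ?sumr_ge0 // ltW.
Qed.

End Regularity.

Lemma ler_sum_card {R : numDomainType} {T : finType} (F : T -> R) (x : R) :
  (forall a, F a <= x) -> \sum_a F a <= x * #|T|%:R.
Proof. by move=> Fx; rewrite mulr_natr -sumr_const; apply: ler_sum. Qed.

Lemma sum_small_cells {R : realFieldType} {T L : finType} (lab : T -> L)
    (s : R) :
  0 <= s ->
  \sum_b (\sum_(b' | lab b' == lab b) 1 < s)%R%:R <= #|L|%:R * s.
Proof.
move=> s0; rewrite (partition_big lab xpredT) //= mulrC.
apply: ler_sum_card => i.
under eq_bigr => b /eqP -> do rewrite -[_%:R]mulr1.
rewrite -mulr_sumr; case: ltP => [/ltW|_]; first by rewrite mul1r.
by rewrite mul0r.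
Qed.

(** * Counting triangles and iterating the refinement *)

Section Removal.
Context {R : realFieldType} {T : finType}.
Variables (E1 E2 E3 : rel T).

Definition triangles : R :=
  \sum_a \sum_b \sum_c ([&& E1 a b, E2 a c & E3 b c])%:R.

Variable m : T -> T -> T.
Hypothesis m_injr : forall a, injective (m a).
Hypothesis m_injl : forall b, injective (m^~ b).

(** The substitution c = m a b is bijective at fixed a, and in [sum_m2] at fixed b: this is how
    edge-disjointness enters. *)
Lemma sum_m1 (F : T -> T -> R) :
  \sum_a \sum_b F a (m a b) = \sum_a \sum_c F a c.
Proof.
by apply: eq_bigr => a _; rewrite [RHS](reindex_inj (@m_injr a)).
Qed.

Lemma sum_m2 (F : T -> T -> R) :
  \sum_a \sum_b F b (m a b) = \sum_b \sum_c F b c.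
Proof.
rewrite exchange_big /=; apply: eq_bigr => b _.
by rewrite [RHS](reindex_inj (@m_injl b)).
Qed.

Definition diagonal : R :=
  \sum_a \sum_b ([&& E1 a b, E2 a (m a b) & E3 b (m a b)])%:R.

(** A diagonal triangle can fail to be good in six ways, each costing at most e N^2, so 6 e N^2 good
    ones remain. At fixed a, different good b may find the same triangles, hence a loss of a factor
    N. *)
Lemma few_irregular_triangles (I J : finType) (phi : T -> I) (psi : T -> J)
    (e : R) (M : nat) :
    0 < e -> (0 < M)%N -> (#|I| <= M)%N -> (#|J| <= M)%N -> (0 < #|T|)%N ->
    12 * e * #|T|%:R ^+ 2 <= diagonal ->
    \sum_b \sum_c (irregular E1 E2 E3 phi psi e (phi b) (psi c))%:R
      <= e * #|T|%:R ^+ 2 ->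
  3 * e ^+ 6 / M%:R ^+ 2 * #|T|%:R ^+ 3 <= triangles.
Proof.
move=> e0 M0 IM JM N0 diag irr; set N : R := #|T|%:R.
have NR : 0 < N by rewrite ltr0n.
have MR : 0 < M%:R :> R by rewrite ltr0n.
(* At most M cells smaller than s cover at most M s = e N points. *)
pose s := e * N / M%:R.
have s0 : 0 <= s by rewrite divr_ge0 ?mulr_ge0 // ltW.
pose P b : R := \sum_(b' | phi b' == phi b) 1.
pose Q c : R := \sum_(c' | psi c' == psi c) 1.
pose u a b : R := cexp phi (fun b => (E1 a b)%:R) b.
pose v a c : R := cexp psi (fun c => (E2 a c)%:R) c.
pose d b c : R := density E3 phi psi (b, c).
pose ir b c := irregular E1 E2 E3 phi psi e (phi b) (psi c).
pose good a b := let c := m a b in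
  [&& E1 a b, E2 a c & E3 b c] &&
  [&& s <= P b, s <= Q c, e <= u a b, e <= v a c, e <= d b c & ~~ ir b c].
have small (L : finType) (lab : T -> L) : (#|L| <= M)%N ->
    \sum_b (\sum_(b' | lab b' == lab b) 1 < s)%R%:R <= e * N.
  move=> LM; apply: le_trans (sum_small_cells lab s0) _.
  apply: (@le_trans _ _ (M%:R * s)); first by rewrite ler_wpM2r // ler_nat.
  by rewrite /s mulrC divfK // gt_eqF.
have bad1 : \sum_(a : T) \sum_b (P b < s)%R%:R <= e * N ^+ 2.
  rewrite expr2 mulrA. apply: ler_sum_card => a.
  exact: small.
have bad2 : \sum_a \sum_b (Q (m a b) < s)%R%:R <= e * N ^+ 2.
  rewrite (sum_m1 (fun a c => (Q c < s)%R%:R)).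
  rewrite expr2 mulrA; apply: ler_sum_card => a.
  exact: small.
have bad3 : \sum_a \sum_b (E1 a b)%:R * (u a b < e)%R%:R <= e * N ^+ 2.
  rewrite expr2 mulrA; apply: ler_sum_card => a.
  by apply: sum_cexp_low; exact: ltW.
have bad4 : \sum_a \sum_b (E2 a (m a b))%:R * (v a (m a b) < e)%R%:R
    <= e * N ^+ 2.
  rewrite (sum_m1 (fun a c => (E2 a c)%:R * (v a c < e)%R%:R)).
  rewrite expr2 mulrA; apply: ler_sum_card => a.
  by apply: sum_cexp_low; exact: ltW.
have bad5 : \sum_a \sum_b (E3 b (m a b))%:R * (d b (m a b) < e)%R%:R
    <= e * N ^+ 2.
  rewrite (sum_m2 (fun b c => (E3 b c)%:R * (d b c < e)%R%:R)) pair_bigA /=.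
  rewrite expr2 -natrM -card_prod.
  under eq_bigr => p _ do rewrite /d -surjective_pairing.
  by apply: sum_cexp_low; exact: ltW.
have bad6 : \sum_a \sum_b (ir b (m a b))%:R <= e * N ^+ 2.
  by rewrite (sum_m2 (fun b c => (ir b c)%:R)).
have manygood : 6 * e * N ^+ 2 <= \sum_a \sum_b (good a b)%:R.
  suff : diagonal <= \sum_a \sum_b ((good a b)%:R + ((P b < s)%R%:R +
      ((Q (m a b) < s)%R%:R + ((E1 a b)%:R * (u a b < e)%R%:R +
      ((E2 a (m a b))%:R * (v a (m a b) < e)%R%:R +
      ((E3 b (m a b))%:R * (d b (m a b) < e)%R%:R + (ir b (m a b))%:R)))))).
    have sum2D (F G : T -> T -> R) : \sum_a \sum_b (F a b + G a b) =
        \sum_a \sum_b F a b + \sum_a \sum_b G a b.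
      by rewrite -big_split; apply: eq_bigr => a _; rewrite big_split.
    rewrite !sum2D; move: diag; rewrite -/N; lra.
  apply: ler_sum => a _; apply: ler_sum => b _.
  rewrite -!natrM -!natrD ler_nat /good /= !leNgt.
  case: (E1 a b) => //; case: (E2 a _) => //; case: (E3 b _) => //.
  by do 5!case: (_ < _)%R => //; case: (ir b (m a b)).
have goodP a b : (good a b)%:R * (e ^+ 3 / 2 * s ^+ 2) <=
    \sum_b \sum_c ([&& E1 a b, E2 a c & E3 b c])%:R.
  case gab: (good a b); last first.
    by rewrite mul0r sumr_ge0 // => b' _; rewrite sumr_ge0.
  rewrite mul1r; case/andP: gab => _ /and5P[sP sQ eu ev /andP[ed nir]].
  exact: (regular_triangles e0 s0 sP sQ eu ev ed nir).
have : (\sum_a \sum_b (good a b)%:R) * (e ^+ 3 / 2 * s ^+ 2) <= N * triangles.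
  rewrite mulr_suml mulr_sumr; apply: ler_sum => a _.
  rewrite mulr_suml [X in _ <= X]mulrC; apply: ler_sum_card => b.
  exact: goodP.
have : 6 * e * N ^+ 2 * (e ^+ 3 / 2 * s ^+ 2) <=
    (\sum_a \sum_b (good a b)%:R) * (e ^+ 3 / 2 * s ^+ 2).
  by apply: ler_wpM2r => //; rewrite mulr_ge0 ?divr_ge0 ?exprn_ge0 // ltW.
move=> /le_trans /[apply].
have -> : 6 * e * N ^+ 2 * (e ^+ 3 / 2 * s ^+ 2) =
    N * (3 * e ^+ 6 / M%:R ^+ 2 * N ^+ 3).
  by rewrite /s; field; rewrite gt_eqF.
by rewrite ler_pM2l.
Qed.

End Removal.

(** Either few pairs are irregular and triangles can be counted, or a refinement raises the energy
    by more than e^5/4 |T|^2. As the energy is at most |T|^2, n bounds the refinements still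
    possible. *)
Lemma energy_iteration {R : realFieldType} (e : R) (n M : nat) :
  0 < e -> (0 < M)%N ->
  exists2 delta : R, 0 < delta &
  forall (T I J : finType) (E1 E2 E3 : rel T) (m : T -> T -> T)
    (phi : T -> I) (psi : T -> J),
  (forall a, injective (m a)) -> (forall b, injective (m^~ b)) ->
  (0 < #|T|)%N -> (#|I| <= M)%N -> (#|J| <= M)%N ->
  12 * e * #|T|%:R ^+ 2 <= diagonal E1 E2 E3 m ->
  (1 - n%:R * (e ^+ 5 / 4)) * #|T|%:R ^+ 2
    < \sum_p density E3 phi psi p ^+ 2 ->
  delta * #|T|%:R ^+ 3 <= triangles E1 E2 E3.
Proof.
move=> e0; elim: n M => [|n IHn] M M0.
  (* For n = 0 the energy would exceed its maximum, so any constant serves. *)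
  exists 1 => // T I J E1 E2 E3 m phi psi _ _ _ _ _ _.
  rewrite mul0r subr0 mul1r => /lt_le_trans /(_ (energy_le _ _)).
  suff E : \sum_p (E3 p.1 p.2)%:R ^+ 2 <= #|T|%:R ^+ 2 :> R.
    by move=> /lt_le_trans /(_ E); rewrite ltxx.
  rewrite -[leRHS]mul1r expr2 -natrM -card_prod; apply: ler_sum_card => p.
  by case: E3; rewrite ?expr0n ?expr1n.
have [] := IHn (M * 2 ^ M)%N; first by rewrite muln_gt0 M0 expn_gt0.
move=> d d0 dP.
pose d1 : R := 3 * e ^+ 6 / M%:R ^+ 2.
have d10 : 0 < d1 by rewrite divr_gt0 ?mulr_gt0 ?exprn_gt0 ?ltr0n.
exists (Num.min d d1); first by rewrite lt_min d0.
move=> T I J E1 E2 E3 m phi psi mr ml N0 IM JM diag en.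
have [irr|irr] := lerP (\sum_b \sum_c
    (irregular E1 E2 E3 phi psi e (phi b) (psi c))%:R) (e * #|T|%:R ^+ 2).
  apply: le_trans (few_irregular_triangles mr ml e0 M0 IM JM N0 diag irr).
  by rewrite ler_wpM2r ?exprn_ge0 // ge_min lexx orbT.
have labels (K L : finType) : (#|K| <= M)%N -> (#|L| <= M)%N ->
    (#|{: K * {ffun L -> bool}}| <= M * 2 ^ M)%N.
  by move=> KM LM; rewrite card_prod card_ffun card_bool leq_mul // leq_exp2l.
apply: le_trans (dP _ _ _ _ _ _ _ (refine1 E1 E2 E3 phi psi e)
  (refine2 E1 E2 E3 phi psi e) mr ml N0 (labels _ _ IM JM) (labels _ _ JM IM)
  diag _).
  by rewrite ler_wpM2r ?exprn_ge0 // ge_min lexx.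
have := energy_increment E1 E2 E3 phi psi e0.
have : e ^+ 4 / 4 * (e * #|T|%:R ^+ 2) < e ^+ 4 / 4 * \sum_b \sum_c
    (irregular E1 E2 E3 phi psi e (phi b) (psi c))%:R.
  by rewrite ltr_pM2l // divr_gt0 // exprn_gt0.
move: en; rewrite /density -natr1 /=; lra.
Qed.

(* A triangle removal lemma for edge-disjoint families of triangles: those of
   [diagonal] share no edge because [m] is a Latin square. *)
Lemma triangle_removal {R : archiRealFieldType} (theta : R) : 0 < theta ->
  exists2 delta : R, 0 < delta &
  forall (T : finType) (E1 E2 E3 : rel T) (m : T -> T -> T),
  (forall a, injective (m a)) -> (forall b, injective (m^~ b)) ->
  theta * #|T|%:R ^+ 2 <= diagonal E1 E2 E3 m ->
  delta * #|T|%:R ^+ 3 <= triangles E1 E2 E3.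
Proof.
move=> theta0; pose e := theta / 12; have e0 : 0 < e by rewrite divr_gt0.
(* With n e^5/4 > 1 the energy hypothesis holds even for the one-cell partition. *)
pose n := Num.bound ((e ^+ 5 / 4)^-1).
have [d d0 dP] := energy_iteration n e0 (ltn0Sn 0).
exists d => // T E1 E2 E3 m mr ml diag.
have [N0|] := posnP #|T|.
  rewrite N0 expr0n mulr0 /triangles; do 3![apply: sumr_ge0 => ? _].
  by rewrite ler0n.
move=> N0; apply: (dP T unit unit E1 E2 E3 m (fun=> tt) (fun=> tt)) => //.
- by rewrite card_unit.
- by rewrite card_unit.
- by have -> : 12 * e = theta by rewrite /e; field.
- have k0 : 0 < e ^+ 5 / 4 by rewrite divr_gt0 // exprn_gt0.
  have n1 : 1 < n%:R * (e ^+ 5 / 4).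
    rewrite -ltr_pdivrMr // div1r; apply: archi_boundP.
    by rewrite invr_ge0 ltW.
  apply: (@lt_le_trans _ _ 0); last by apply: sumr_ge0 => p _; exact: sqr_ge0.
  by rewrite pmulr_llt0 ?subr_lt0 // exprn_gt0 ?ltr0n.
Qed.

(** * Monochromatic quadruples *)

Lemma natr_forall {R : comPzSemiRingType} {I : finType} (P : pred I) :
  ([forall i, P i])%:R = \prod_i (P i)%:R :> R.
Proof.
case: forallP => [PP|nP]; first by rewrite big1 // => i _; rewrite PP.
have /existsP[i nPi] : [exists i, ~~ P i].
  by rewrite -negb_forall; apply/forallP.
by rewrite (bigD1 i) //= (negbTE nPi) mul0r.
Qed.

Section Colouring.
Context {R : archiRealFieldType} {gT : finGroupType} {k : nat}.
Variable f : gT -> 'I_k.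

Definition class_size (i : 'I_k) : R := \sum_x (f x == i)%:R.

Definition schur_quadruple (x y : gT) : bool :=
  [&& f x == f y, f x == f (x * y)%g & f x == f (y * x)%g].

(** Average over all t: at fixed a and b the count of valid t is a product over the colours, where a
    dense colour allows at least eta |G| values of t i and any other allows all |G|. *)
Lemma common_shift (eta : R) (dense : pred 'I_k) : 0 < eta -> eta <= 1 ->
  (forall i, dense i -> eta * #|gT|%:R <= class_size i) ->
  exists t : {ffun 'I_k -> gT},
  eta ^+ k * #|gT|%:R ^+ 2 <=
  \sum_a \sum_b ([forall i, dense i ==> (f (b * t i * a)%g == i)])%:R.
Proof.
move=> eta0 eta1 denseP; set N : R := #|gT|%:R.
have N0 : 0 < N by rewrite ltr0n; apply/card_gt0P; exists 1%g.
have prodP a b : (eta * N) ^+ k <=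
    \sum_(t : {ffun 'I_k -> gT})
      ([forall i, dense i ==> (f (b * t i * a)%g == i)])%:R.
  under eq_bigr do rewrite natr_forall.
  rewrite -(bigA_distr_bigA
    (fun i h => (dense i ==> (f (b * h * a)%g == i))%:R)).
  rewrite -[X in _ ^+ X]card_ord -prodr_const; apply: ler_prod => i _.
  apply/andP; split; first by rewrite mulr_ge0 // ltW.
  case di: (dense i) => /=; last first.
    have -> : \sum_(h : gT) 1 = N by rewrite sumr_const.
    by rewrite ger_pMl.
  apply: le_trans (denseP i di) _.
  rewrite /class_size (reindex (fun h => b * h * a)%g) //=.
  exists (fun h => b^-1 * h * a^-1)%g => h _; rewrite !mulgA.
    by rewrite mulVg mul1g mulgK.
  by rewrite mulgV mul1g mulgKV.
have [/existsP[t]|/existsPn noshift] := boolP [exists t : {ffun 'I_k -> gT},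
    eta ^+ k * N ^+ 2 <=
    \sum_a \sum_b ([forall i, dense i ==> (f (b * t i * a)%g == i)])%:R].
  by exists t.
have : \sum_(t : {ffun 'I_k -> gT}) \sum_a \sum_b
    ([forall i, dense i ==> (f (b * t i * a)%g == i)])%:R <
    \sum_(t : {ffun 'I_k -> gT}) eta ^+ k * N ^+ 2.
  apply: ltr_sum; last by move=> t _; rewrite ltNge.
  by apply/hasP; exists [ffun => 1%g]; rewrite ?mem_index_enum.
rewrite sumr_const card_ffun card_ord -mulr_natr natrX -/N exchange_big /=.
under eq_bigr do rewrite exchange_big /=.
suff : N * (N * (eta * N) ^+ k) <= \sum_a \sum_b \sum_(t : {ffun 'I_k -> gT})
    ([forall i, dense i ==> (f (b * t i * a)%g == i)])%:R.
  by move=> /le_lt_trans /[apply]; rewrite exprMn; lra.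
have sumc (x : R) : N * x = \sum_(a : gT) x.
  by rewrite sumr_const -mulr_natl.
rewrite !sumc; apply: ler_sum => a _; apply: ler_sum => b _.
exact: prodP.
Qed.

Section Gap.
Variables (eta eta' delta : R).
Hypotheses (eta0 : 0 < eta) (eta1 : eta <= 1) (delta0 : 0 < delta).
Hypothesis removal : forall (E1 E2 E3 : rel gT),
  eta ^+ k * #|gT|%:R ^+ 2 <= diagonal E1 E2 E3 mulg ->
  delta * #|gT|%:R ^+ 3 <= triangles E1 E2 E3.
Hypothesis eta'0 : 0 <= eta'.
Hypothesis eta'_small : k%:R * eta' <= delta / 2.
Hypothesis gap : forall i, class_size i < eta * #|gT|%:R ->
  class_size i <= eta' * #|gT|%:R.

(** Elements g of sparse colour number at most k eta' |G|, so they spoil at most half of the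
    triangles. Each pair (x, g) comes from at most |G| of the remaining ones, one for each a. *)
Lemma gap_schur_quadruples :
  delta / 2 * #|gT|%:R ^+ 2 <= \sum_x \sum_y (schur_quadruple x y)%:R.
Proof.
set N : R := #|gT|%:R.
have N0 : 0 < N by rewrite ltr0n; apply/card_gt0P; exists 1%g.
pose dense i := eta * N <= class_size i.
have [t tP] := common_shift eta0 eta1 (fun i (di : dense i) => di).
pose E1 a b := [forall i, dense i ==> (f (b * t i * a)%g == i)].
pose E2 a c := [forall i, dense i ==> (f (a^-1 * c * t i * a)%g == i)].
pose E3 b c := [forall i, dense i ==> (f (b * t i * c * b^-1)%g == i)].
have := removal (E1 := E1) (E2 := E2) (E3 := E3).
have -> : diagonal E1 E2 E3 mulg = \sum_a \sum_b (E1 a b)%:R :> R.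

  apply: eq_bigr => a _; apply: eq_bigr => b _; congr (nat_of_bool _)%:R.
  have -> : E2 a (a * b)%g = E1 a b.
    by apply: eq_forallb => i; rewrite !mulgA mulVg mul1g.
  have -> : E3 b (a * b)%g = E1 a b.
    by apply: eq_forallb => i; rewrite !mulgA mulgK.
  by rewrite !andbb.
move=> /(_ tP); rewrite -/N => tri.
pose bad g : R := (~~ dense (f g))%:R.
have badP : \sum_g bad g <= delta / 2 * N.
  apply: (@le_trans _ _ (k%:R * (eta' * N))); last first.
    by rewrite mulrA ler_wpM2r // ltW.
  rewrite (partition_big f xpredT) //= mulrC -[X in _ * X%:R]card_ord.
  apply: ler_sum_card => i.
  under eq_bigr => x /eqP fx do rewrite /bad fx.
  case: (boolP (dense i)) => [_|]; first by rewrite big1 // mulr_ge0 // ltW.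
  rewrite -ltNge => /gap; apply: le_trans.
  by rewrite big_mkcond; apply: ler_sum => x _; case: eqP.
have : triangles E1 E2 E3 <= \sum_a \sum_b \sum_g
    (bad g + (schur_quadruple (b * t (f g) * a)%g g)%:R) :> R.
  apply: ler_sum => a _; apply: ler_sum => b _.
  (* Replace the variable g by a^-1 c b^-1. *)
  rewrite [leRHS](reindex_inj (mulgI (a^-1)%g)) /=.
  rewrite [leRHS](reindex_inj (mulIg (b^-1)%g)) /=.
  apply: ler_sum => c _; set g := (_ * _)%g.
  rewrite /bad; case: (boolP (dense (f g))) => dg; last first.
    by rewrite -[leLHS]addr0 lerD // lern1; case: and3P.
  rewrite add0r ler_nat; case: and3P => // -[/forallP/(_ (f g)) +
    /forallP/(_ (f g)) + /forallP/(_ (f g))]; rewrite dg /=.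
  move=> /eqP fx /eqP fgx /eqP fxg.
  rewrite /schur_quadruple fx eqxx.
  have -> : (b * t (f g) * a * g = b * t (f g) * c * b^-1)%g.
    by rewrite [in X in (_ * X)%g]/g !mulgA mulgK.
  have -> : (g * (b * t (f g) * a) = a^-1 * c * t (f g) * a)%g.
    by rewrite [in X in (X * _)%g]/g !mulgA mulgKV.
  by rewrite fxg fgx eqxx.
move=> /(le_trans tri) {}tri.
set Q := \sum_x _.
have : delta * N ^+ 3 <= (delta / 2 * N * N + Q) * N.
  apply: le_trans tri _; apply: ler_sum_card => a.
  under eq_bigr do rewrite big_split.
  rewrite big_split lerD //=; first by apply: ler_sum_card.
  rewrite exchange_big /Q [leRHS]exchange_big /=; apply: ler_sum => g _.
  rewrite [leRHS](reindex_inj (mulIg (t (f g) * a)%g)) /=.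
  by apply: ler_sum => b _; rewrite mulgA.
have -> : delta * N ^+ 3 = (delta * N ^+ 2) * N by ring.
rewrite ler_pM2r //; lra.
Qed.

End Gap.
End Colouring.

Arguments class_size {R gT k} f i.

(* By induction on the number of colours of density below [eta]: either none of
   them has density between [eta'] and [eta], or fewer have density below
   [eta']. *)
Lemma many_schur_quadruples_scale {R : archiRealFieldType} (k m : nat)
    (eta : R) :
  0 < eta -> eta <= 1 ->
  exists2 delta : R, 0 < delta & forall (gT : finGroupType) (f : gT -> 'I_k),
  (#|[pred i | (class_size f i < eta * #|gT|%:R)%R]| <= m)%N ->
  delta * #|gT|%:R ^+ 2 <= \sum_x \sum_y (schur_quadruple f x y)%:R :> R.
Proof.
elim: m eta => [|m IHm] eta eta0 eta1.
all: have [d d0 removal] := triangle_removal (exprn_gt0 k eta0).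
all: have rem (gT : finGroupType) (E1 E2 E3 : rel gT) :=
  removal gT E1 E2 E3 mulg (@mulgI gT) (@mulIg gT).
  exists (d / 2) => [|gT f]; first by rewrite divr_gt0.
  rewrite leqn0 => /eqP/card0_eq none.
  apply: (gap_schur_quadruples eta0 eta1 (eta' := 0) (rem gT)) => //.
    by rewrite mulr0 divr_ge0 // ltW.
  by move=> i; have := none i; rewrite inE => ->.
(* Chosen so that k eta' <= d/2; the successor avoids a zero denominator. *)
pose eta' := Num.min eta (d / (2 * k.+1%:R)).
have eta'0 : 0 < eta' by rewrite lt_min eta0 divr_gt0 // mulr_gt0 // ltr0n.
have eta'1 : eta' <= 1 by rewrite ge_min eta1.
have small : k%:R * eta' <= d / 2.
  apply: (@le_trans _ _ (k.+1%:R * (d / (2 * k.+1%:R)))).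
    apply: ler_pM; [exact: ler0n | exact: ltW | by rewrite ler_nat |].
    by rewrite ge_min lexx orbT.
  have : k.+1%:R != 0 :> R by rewrite pnatr_eq0.
  by move: k.+1%:R => K K0; rewrite le_eqVlt; apply/orP; left; apply/eqP; field.
have [d' d'0 IH] := IHm eta' eta'0 eta'1.
exists (Num.min (d / 2) d') => [|gT f fm]; first by rewrite lt_min d'0 divr_gt0.
have [gap|] := boolP [forall i,
    (class_size f i < eta * #|gT|%:R) ==> (class_size f i <= eta' * #|gT|%:R)].
  apply: le_trans (gap_schur_quadruples eta0 eta1 (rem gT) (ltW eta'0) small _).
    by rewrite ler_wpM2r ?exprn_ge0 // ge_min lexx.
  by move=> i lti; have /forallP/(_ i)/implyP/(_ lti) := gap.
(* A colour i between the two thresholds is sparse for eta but not for eta', so the number of sparse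
   colours drops. *)
rewrite negb_forall => /existsP[i]; rewrite negb_imply -ltNge => /andP[lti gti].
apply: le_trans (IH gT f _).
  by rewrite ler_wpM2r ?exprn_ge0 // ge_min lexx orbT.
rewrite -ltnS; apply: leq_trans fm; apply: proper_card; apply/properP; split.
  apply/fintype.subsetP => j; rewrite !inE => /lt_le_trans; apply.
  by rewrite ler_wpM2r // ge_min lexx.
by exists i; rewrite inE // -leNgt ltW.
Qed.

Lemma many_schur_quadruples {R : archiRealFieldType} (k : nat) :
  exists2 delta : R, 0 < delta & forall (gT : finGroupType) (f : gT -> 'I_k),
  delta * #|gT|%:R ^+ 2 <= \sum_x \sum_y (schur_quadruple f x y)%:R :> R.
Proof.
have [d d0 dP] := many_schur_quadruples_scale k k (@ltr01 R) (lexx 1).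
exists d => // gT f; apply: dP; rewrite -[X in (_ <= X)%N]card_ord.
exact: max_card.
Qed.

(** * From colourings to covers *)

Lemma schur_property_of_colouring (gT : finGroupType) (G : {group gT}) k :
  (forall c : subg_of G -> 'I_k, exists x y, schur_quadruple c x y /\
     (x * y != y * x)%g) -> schur_property G k.
Proof.
move=> H; apply/forallP => C; apply/implyP => /eqP CG.
(* Colour each element by the index of some member of the cover that contains it. *)
have /fin_all_exists[c cP] (u : subg_of G) : exists i, sgval u \in C i.
  have : sgval u \in \bigcup_(i < k) C i by rewrite CG subgP.
  by case/bigcupP=> i _ ui; exists i.
have [x [y [/and3P[/eqP cy /eqP cxy /eqP cyx] xy]]] := H c.
apply/existsP; exists (c x); apply/existsP; exists (sgval x).
apply/existsP; exists (sgval y).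
rewrite cP {1}cy cP cxy (cP (x * y)%g) -cxy cyx (cP (y * x)%g) /=.
by apply: contra xy => /eqP E; apply/eqP; apply: val_inj.
Qed.

Lemma sum_commuting_subg {R : numDomainType} (gT : finGroupType)
    (G : {group gT}) :
  \sum_(x : subg_of G) \sum_(y : subg_of G) ((x * y == y * x)%g)%:R
    <= #|commuting_pairs G|%:R :> R.
Proof.
rewrite pair_bigA /= -natr_sum ler_nat -big_mkcond sum1_card /=.
pose h (p : subg_of G * subg_of G) := (sgval p.1, sgval p.2).
have hinj : injective h by move=> [a b] [a' b'] [] /val_inj -> /val_inj ->.
rewrite -(card_imset _ hinj); apply/subset_leq_card/fintype.subsetP.
move=> _ /imsetP[[x y] + ->]; rewrite !inE /= !subgP /= unfold_in /=.
by move/eqP=> E; apply/eqP.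
Qed.

(** If all monochromatic quadruples commuted, they would force at least delta |G|^2 commuting
    pairs. *)
Lemma large_schur_number {R : archiRealFieldType} (k : nat) :
  exists2 delta : R, 0 < delta & forall (gT : finGroupType) (G : {group gT}),
  commuting_prob R G < delta -> schur_property G k.
Proof.
have [d d0 dP] := @many_schur_quadruples R k.
exists d => // gT G; rewrite ltr_pdivrMr; last first.
  by rewrite exprn_gt0 // ltr0n cardG_gt0.
rewrite -/(commuting_pairs G) => small.
apply: schur_property_of_colouring => c.
have [/existsP[x /existsP[y /andP[xy nxy]]]|none] := boolP [exists x, exists y,
    schur_quadruple c x y && (x * y != y * x)%g]; first by exists x, y.
have := dP _ c; rewrite leNgt => /negP[].
have -> : #|subg_of G| = #|G| by rewrite -cardsT -(card_isog (isog_subg G)).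
apply: le_lt_trans small; apply: le_trans (sum_commuting_subg G).
apply: ler_sum => x _; apply: ler_sum => y _; rewrite ler_nat.
move: none; rewrite negb_exists => /forallP/(_ x).
rewrite negb_exists => /forallP/(_ y); rewrite negb_and negbK.
by case: (schur_quadruple c x y) => //= ->.
Qed.

(** * The equivalence of the two limits *)

Local Open Scope classical_set_scope.
Local Open Scope ring_scope.

Theorem theorem1p4 (R : realType) (gT : nat -> finGroupType)
    (G : forall n : nat, {group gT n})
    (nonabelianG : forall n : nat, ~~ abelian (G n)) :
  ((fun n : nat => commuting_prob R (G n)) @ \oo --> (0 : R))
  <-> ((fun n : nat => schur_number (G n)) @ \oo --> \oo).
Proof.
have prob_ge0 n : 0 <= commuting_prob R (G n) by rewrite divr_ge0 // exprn_ge0.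
split=> [/cvgr0Pnorm_lt c0|/cvgnyPge kG].
  apply/cvgnyPge => k; have [d d0 dP] := @large_schur_number R k.
  near=> n; have [_] := schur_numberP (G n); apply; apply: dP.
  by rewrite -[ltLHS]ger0_norm //; near: n; exact: c0.
(* As b > 1/eps, a commuting probability of at least eps is at least 1/b, which caps the Schur
   number. *)
apply/cvgr0Pnorm_lt => eps eps0; pose b := (Num.bound eps^-1).
have b0 : 0 < b%:R :> R.
  by apply: lt_trans (archi_boundP _); rewrite ?invr_ge0 ?invr_gt0 // ltW.
near=> n; rewrite ger0_norm // ltNge; apply/negP => epsc.
have : ((2 * b) ^ 4 + 2 * b <= schur_number (G n))%N by near: n; exact: kG.
move=> nb; have [Gn _] := schur_numberP (G n).
suff comm : (#|G n| ^ 2 <= b * #|commuting_pairs (G n)|)%N.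
  by have /negP := small_schur_number comm nb.
rewrite -(ler_nat R) natrX natrM mulrC -ler_pdivrMr //.
have := epsc; rewrite ler_pdivlMr ?exprn_gt0 ?ltr0n ?cardG_gt0 //.
rewrite -/(commuting_pairs _); apply: le_trans.
rewrite mulrC ler_wpM2r ?exprn_ge0 //.
rewrite -[leRHS]invrK lef_pV2 ?posrE ?invr_gt0 // ltW // archi_boundP //.
by rewrite invr_ge0 ltW.
Unshelve. all: by end_near.
Qed.
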